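(* Let $\overrightarrow{\Gamma}$ be the directed graph associated to the triangle with vertex set $I=\{1,2,3\}$ and edge set $E=\{\{1,2\},\{2,3\},\{3,1\}\}$, let $\mathcal{A}_0=\{G_i,G_e,\psi_e\}$ be an amalgam over $\overrightarrow{\Gamma}$, and let $(\mathcal{C}_0,\overrightarrow{\Gamma})$ be its reference graph of groups, with vertex groups $A_1,A_2,A_3$, edge groups $A_{i,i+1}$ and homomorphisms $\alpha_{i,i+1}\colon A_{i,i+1}\to A_i$, $\alpha_{i+1,i}\colon A_{i,i+1}\to A_{i+1}$ (indices modulo $3$). Let $A=A_1\times A_2\times A_3$, with inclusion maps $i_k\colon A_k\to A$ and projection maps $\pi_k\colon A\to A_k$. For $k=1,2,3$ let $\Phi_k\colon A_{k,k+1}\to A$ be given by $\Phi_k(x)=i_k(\alpha_{k,k+1}(x))\cdot i_{k+1}(\alpha_{k+1,k}(x))$, and let $H_k=\mathrm{im}\,\Phi_k$. Define an equivalence relation $\sim$ on $A$ by: $(a_1,a_2,a_3)\sim(a_1',a_2',a_3')$ if and only if there exist $x_1\in H_1$, $x_2\in H_2$, $x_3\in H_3$ such that $$a_k'=\pi_k\big(x_k^{-1}\,i_k(a_k)\,x_{k-1}\big)\quad\text{for all }k=1,2,3.$$ Then the equivalence classes for $\sim$ are in bijection with the isomorphism classes of pointings of $\mathcal{C}_0$.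
   Context: All indices are taken modulo $3$ in $\{1,2,3\}$. **Directed graph.** $\overrightarrow{\Gamma}=(I,\overrightarrow{E})$ has, for each edge $\{i,i+1\}$ of the triangle, the two directed edges $(i,i+1)$ and $(i+1,i)$, opposite to each other; for $e=(i,j)$ write $d_0(e)=i$, $d_1(e)=j$, $\bar e=(j,i)$. **Amalgam.** An amalgam over $\overrightarrow{\Gamma}$ is a collection $\{G_i,G_e,\psi_e\mid i\in I,e\in\overrightarrow{E}\}$, where $G_i$ and $G_e=G_{\bar e}$ are groups and $\psi_e\colon G_{d_0(e)}\to G_e$ is an injective homomorphism for each $e\in\overrightarrow{E}$. **Reference graph.** The reference graph $(\mathcal{C}_0,\overrightarrow{\Gamma})=\{A_i,A_e,\alpha_e\}$ of $\mathcal{A}_0$ is the graph of groups with $A_i=\mathrm{Aut}(G_i)$; $A_e=A_{\bar e}$ the group of automorphisms of $G_e$ that leave invariant each of the two subgroups $\psi_e(G_{d_0(e)})$ and $\psi_{\bar e}(G_{d_1(e)})$ of $G_e$; and $\alpha_e\colon A_e\to A_{d_0(e)}$ given by $\alpha_e(a)=\psi_e^{-1}\circ a\circ\psi_e$, where $\psi_e^{-1}$ is the inverse of $\psi_e$ viewed as an isomorphism onto its image. One writes $A_{i,i+1}$ for the group $A_e=A_{\bar e}$ with $e=(i,i+1)$, and $\alpha_{i,j}$ for $\alpha_e$ with $e=(i,j)$. **Pointings.** A pointing of $\mathcal{C}_0$ is given by a collection $\delta=\{\delta_e\mid e\in\overrightarrow{E}\}$ of elements $\delta_e\in A_{d_0(e)}$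 (together with the graph of groups obtained by replacing $\alpha_e$ by $x\mapsto\delta_e\alpha_e(x)\delta_e^{-1}$). Two pointings $\delta^{(1)},\delta^{(2)}$ of $\mathcal{C}_0$ are isomorphic if there are elements $a_i\in A_i$ ($i\in I$) and $a_e=a_{\bar e}\in A_e$ ($e\in\overrightarrow{E}$) such that $\delta_e^{(1)}\alpha_e(a_e)=a_{d_0(e)}\delta_e^{(2)}$ for all $e\in\overrightarrow{E}$. *)

(* Defs.v *)
From HB Require Import structures.
From Corelib Require Export RelationClasses.
From mathcomp Require Export all_boot.
From mathcomp Require Export boolp classical_sets functions.

Set Implicit Arguments.
Unset Strict Implicit.
Unset Printing Implicit Defensive.

Local Open Scope classical_set_scope.
Local Open Scope group_scope.

Notation group_hom := UMagmaMorphism.type.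

Definition is_aut (G : groupType) : pred (G -> G) :=
  fun f => `[< {morph f : x y / x * y} /\ bijective f >].

Record aut (G : groupType) := Aut { aut_fun :> G -> G; autP : is_aut aut_fun }.

HB.instance Definition _ (G : groupType) := [isSub for @aut_fun G].
HB.instance Definition _ (G : groupType) := [Choice of aut G by <:].

Section AutGroup.
Variable G : groupType.
Implicit Types f g : aut G.

Lemma autM f : {morph f : x y / x * y}.
Proof. by have /asboolP[] := autP f. Qed.

Lemma aut_bij f : bijective f.
Proof. by have /asboolP[] := autP f. Qed.

Lemma aut_ext f g : f =1 g -> f = g.
Proof. by move=> fg; apply: val_inj; apply: funext. Qed.

Lemma is_aut_id : is_aut (@id G).
Proof. by apply/asboolP; split=> //; exists id. Qed.

Lemma is_aut_comp f g : is_aut (f \o g).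
Proof.
apply/asboolP; split=> [x y /=|]; first by rewrite !autM.
exact: bij_comp (aut_bij f) (aut_bij g).
Qed.

Definition aut_inv_fun f : G -> G := 'pinv_(fun=> 1) setT f.

Lemma aut_funK f : cancel f (aut_inv_fun f).
Proof.
move=> x; apply: pinvKV; last by rewrite inE.
by move=> y z _ _; apply: bij_inj (aut_bij f) _ _.
Qed.

Lemma aut_invK f : cancel (aut_inv_fun f) f.
Proof.
by move=> x; have [h _ fh] := aut_bij f; rewrite -(fh x) aut_funK.
Qed.

Lemma is_aut_inv f : is_aut (aut_inv_fun f).
Proof.
apply/asboolP; split=> [x y|]; last first.
  by exists f; [exact: aut_invK|exact: aut_funK].
by apply: (can_inj (aut_funK f)); rewrite autM !aut_invK.
Qed.

Let one := Aut is_aut_id.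
Let mul f g := Aut (is_aut_comp f g).
Let inv f := Aut (is_aut_inv f).

Let mulA : associative mul. Proof. by move=> f g h; apply: aut_ext. Qed.
Let mul1 : left_id one mul. Proof. by move=> f; apply: aut_ext. Qed.
Let mulr1 : right_id one mul. Proof. by move=> f; apply: aut_ext. Qed.
Let mulV : left_inverse one inv mul.
Proof. by move=> f; apply: aut_ext => x; exact: aut_funK. Qed.
Let mulrV : right_inverse one inv mul.
Proof. by move=> f; apply: aut_ext => x; exact: aut_invK. Qed.

HB.instance Definition _ := isGroup.Build (aut G) mulA mul1 mulr1 mulV mulrV.

Lemma aut_mulE f g x : (f * g) x = f (g x). Proof. by []. Qed.
Lemma aut_1E x : (1 : aut G) x = x. Proof. by []. Qed.
Lemma aut_invKV f x : f (f^-1 x) = x. Proof. exact: aut_invK. Qed.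

End AutGroup.

(* The vertices 1, 2, 3 are the elements of 'I_3, on which [ordS] and
   [ord_pred] are the cyclic k |-> k+1 and k |-> k-1.  The undirected edge
   {k, k+1} is also named by k : 'I_3. *)
Notation vertex := 'I_3 (only parsing).
Notation edge := 'I_3 (only parsing).

(* (k, false) is the directed edge (k, k+1) and (k, true) is (k+1, k).  Data
   indexed by undirected edges and read at [undirected e] satisfy
   X_e = X_(bar e) definitionally. *)
Notation dedge := ('I_3 * bool)%type.
Notation fwd k := ((k, false) : dedge).
Notation bwd k := ((k, true) : dedge).

Definition undirected (e : dedge) : edge := e.1.
Definition bar (e : dedge) : dedge := (e.1, ~~ e.2).
Definition d0 (e : dedge) : vertex := if e.2 then ordS e.1 else e.1.
Definition d1 (e : dedge) : vertex := d0 (bar e).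

Lemma dedge_ends_inj : injective (fun e : dedge => (d0 e, d1 e)).
Proof.
by move=> [[[|[|[|//]]] p] []] [[[|[|[|//]]] q] []] // /eqP;
  rewrite xpair_eqE // => _; congr (_, _); apply: val_inj.
Qed.

Lemma dedge_ends_surj (i j : vertex) :
  i != j -> exists e : dedge, (d0 e, d1 e) = (i, j).
Proof.
case: i j => [[|[|[|//]]] p] [[|[|[|//]]] q] // _;
  by [ exists (fwd (Ordinal p)); congr (_, _); apply: val_inj
     | exists (bwd (Ordinal q)); congr (_, _); apply: val_inj ].
Qed.

Lemma d0_neq_d1 (e : dedge) : d0 e != d1 e.
Proof. by case: e => [[[|[|[|//]]] pk] []]. Qed.

Record amalgam := Amalgam {
  vG : vertex -> groupType;
  eG : edge -> groupType;
  psi : forall e : dedge, group_hom (vG (d0 e)) (eG (undirected e));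
  psi_inj : forall e, injective (psi e)
}.

Record graph_of_groups := GraphOfGroups {
  vA : vertex -> groupType;
  eA : edge -> groupType;
  alpha : forall e : dedge, group_hom (eA (undirected e)) (vA (d0 e))
}.

Section ReferenceGraph.
Variable A0 : amalgam.

Definition psi_im (e : dedge) : set (eG A0 (undirected e)) := range (psi A0 e).
Arguments psi_im e : clear implicits.

Definition stabilizes (k : edge) : pred (aut (eG A0 k)) :=
  fun a => `[< a @` psi_im (fwd k) = psi_im (fwd k) /\
               a @` psi_im (bwd k) = psi_im (bwd k) >].

Record edge_aut (k : edge) :=
  EdgeAut { edge_aut_val :> aut (eG A0 k); edge_autP : stabilizes edge_aut_val }.

HB.instance Definition _ k := [isSub for @edge_aut_val k].
HB.instance Definition _ k := [Choice of edge_aut k by <:].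

Lemma im_autV (G : groupType) (a : aut G) (S : set G) :
  a @` S = S -> (a^-1)%g @` S = S.
Proof.
move=> aS; rewrite -{1}aS image_comp -[RHS]image_id; apply: eq_imagel => x _.
exact: aut_funK.
Qed.

Lemma stabilizes_group_closed k : group_closed (stabilizes (k := k)).
Proof.
split=> [|f g]; first by apply/asboolP; split; exact: image_id.
move=> /asboolP[f1 f2] /asboolP[/im_autV g1 /im_autV g2]; apply/asboolP.
by split; rewrite -image_comp ?g1 ?g2 ?f1 ?f2.
Qed.

HB.instance Definition _ k :=
  SubChoice_isSubGroup.Build _ _ (edge_aut k) (@stabilizes_group_closed k).

Lemma edge_aut_im (e : dedge) (a : edge_aut (undirected e)) :
  a @` psi_im e = psi_im e.
Proof. by case: e a => k [] [a /= /asboolP[]]. Qed.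

(* The inverse of [psi e] on its image; the value 1 elsewhere is junk. *)
Definition psi_inv (e : dedge) : eG A0 (undirected e) -> vG A0 (d0 e) :=
  'pinv_(fun=> 1) setT (psi A0 e).

Lemma psiK e : cancel (psi A0 e) (psi_inv (e := e)).
Proof.
by move=> x; apply: pinvKV; rewrite ?inE// => y z _ _; exact: psi_inj.
Qed.

Lemma psi_invK e (y : eG A0 (undirected e)) :
  psi_im e y -> psi A0 e (psi_inv y) = y.
Proof. by move=> [x _ <-]; rewrite psiK. Qed.

Definition ref_alpha_fun e (a : edge_aut (undirected e)) :
    vG A0 (d0 e) -> vG A0 (d0 e) :=
  psi_inv (e := e) \o a \o psi A0 e.

Lemma psi_ref_alpha_fun e (a : edge_aut (undirected e)) x :
  psi A0 e (ref_alpha_fun a x) = a (psi A0 e x).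
Proof.
by rewrite psi_invK// -(edge_aut_im a); exists (psi A0 e x) => //; exists x.
Qed.

Lemma is_aut_ref_alpha_fun e (a : edge_aut (undirected e)) :
  is_aut (ref_alpha_fun a).
Proof.
apply/asboolP; split=> [x y|].
  by apply: (@psi_inj A0 e); rewrite gmulfM !psi_ref_alpha_fun gmulfM autM.
exists (ref_alpha_fun (a^-1)%g) => x; apply: (@psi_inj A0 e).
  by rewrite !psi_ref_alpha_fun; exact: aut_funK.
by rewrite !psi_ref_alpha_fun; exact: aut_invK.
Qed.

Definition ref_alpha e (a : edge_aut (undirected e)) : aut (vG A0 (d0 e)) :=
  Aut (is_aut_ref_alpha_fun a).

Lemma ref_alpha_monoid e : monoid_morphism (@ref_alpha e).
Proof.
split=> [|a b]; apply: aut_ext => x; apply: (@psi_inj A0 e).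
  by rewrite psi_ref_alpha_fun.
by rewrite aut_mulE !psi_ref_alpha_fun.
Qed.

HB.instance Definition _ e :=
  isUMagmaMorphism.Build _ _ (@ref_alpha e) (@ref_alpha_monoid e).

Definition reference_graph : graph_of_groups :=
  @GraphOfGroups (fun i => aut (vG A0 i)) edge_aut (fun e => @ref_alpha e).

End ReferenceGraph.

Section Pointings.
Variable C : graph_of_groups.

(* The graph of groups carried by a pointing, with structure maps
   x |-> delta_e * alpha_e x * delta_e^-1, is determined by [delta]. *)
Definition pointing := forall e : dedge, vA C (d0 e).

Definition pointing_iso (delta1 delta2 : pointing) : Prop :=
  exists (a : forall i : vertex, vA C i) (b : forall k : edge, eA C k),
    forall e : dedge,
      delta1 e * alpha C e (b (undirected e)) = a (d0 e) * delta2 e.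

Lemma pointing_iso_equiv : Equivalence pointing_iso.
Proof.
split.
- by move=> d; exists (fun=> 1), (fun=> 1) => e; rewrite gmulf1 mulg1 mul1g.
- move=> d d' [a [b ab]]; exists (fun i => (a i)^-1), (fun k => (b k)^-1) => e.
  by rewrite gmulfV; apply: (mulgI (a (d0 e))); rewrite mulgA -ab mulgK mulgA mulgV mul1g.
- move=> d1 d2 d3 [a [b ab]] [a' [b' ab']].
  exists (fun i => a i * a' i), (fun k => b k * b' k) => e.
  by rewrite gmulfM mulgA ab -!mulgA ab'.
Qed.

End Pointings.

Section ProductGroup.
Variable G : vertex -> groupType.

Definition prod_group := forall k : vertex, G k.

HB.instance Definition _ := Choice.copy prod_group (forall k : vertex, G k).

Implicit Types a b c : prod_group.

Let one : prod_group := fun=> 1.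
Let inv a : prod_group := fun k => (a k)^-1.
Let mul a b : prod_group := fun k => a k * b k.

Let mulA : associative mul.
Proof. by move=> a b c; apply: functional_extensionality_dep => k; exact: mulgA. Qed.
Let mul1 : left_id one mul.
Proof. by move=> a; apply: functional_extensionality_dep => k; exact: mul1g. Qed.
Let mulr1 : right_id one mul.
Proof. by move=> a; apply: functional_extensionality_dep => k; exact: mulg1. Qed.
Let mulV : left_inverse one inv mul.
Proof. by move=> a; apply: functional_extensionality_dep => k; exact: mulVg. Qed.
Let mulrV : right_inverse one inv mul.
Proof. by move=> a; apply: functional_extensionality_dep => k; exact: mulgV. Qed.

HB.instance Definition _ := isGroup.Build prod_group mulA mul1 mulr1 mulV mulrV.

Definition incl (k : vertex) (x : G k) : prod_group := @dfwith _ G (fun=> 1) k x.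
Definition prj (k : vertex) (a : prod_group) : G k := a k.

End ProductGroup.
Arguments incl {G} k x.
Arguments prj {G} k a.

Section Triples.
Variable C : graph_of_groups.

Definition Phi (k : 'I_3) (x : eA C k) : prod_group (vA C) :=
  incl k (alpha C (fwd k) x) * incl (ordS k) (alpha C (bwd k) x).

Definition H_ (k : 'I_3) : set (prod_group (vA C)) := range (@Phi k).
Arguments H_ k : clear implicits.

Definition triple_equiv (a a' : prod_group (vA C)) : Prop :=
  exists x : 'I_3 -> prod_group (vA C),
    (forall k, H_ k (x k)) /\
    forall k, a' k = prj k ((x k)^-1 * incl k (a k) * x (ord_pred k)).

End Triples.
Arguments pointing_iso C delta1 delta2 : clear implicits.
Arguments triple_equiv C a a' : clear implicits.

(* R x is the class {y | R x y} of x. *)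
Definition classes (T : Type) (R : T -> T -> Prop) : set (set T) := range R.

(* Main.v *)
(* An isomorphism (a_i, a_e) of pointings multiplies both delta_(i,i+1) and
   delta_(i,i-1) on the left by a_i^-1, so a pointing can be normalized to have
   every delta_(i,i+1) = 1.  What remains is the triple of elements
   delta_(i,i+1)^-1 * delta_(i,i-1), and an isomorphism of normalized pointings
   must have a_i = alpha_(i,i+1)(a_(i,i+1)), which turns the remaining
   conditions into the relation ~ on triples. *)

Require Import Defs.

Set Implicit Arguments.
Unset Strict Implicit.
Unset Printing Implicit Defensive.

Local Open Scope classical_set_scope.
Local Open Scope group_scope.

Section ClassTransfer.
Variables (T U : Type) (R : T -> T -> Prop) (S : U -> U -> Prop) (F : T -> U).
Hypothesis S_equiv : Equivalence S.
Hypothesis F_iff : forall x y, R x y <-> S (F x) (F y).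

Lemma equivalence_preimage : Equivalence R.
Proof.
case: S_equiv => S_refl S_sym S_trans; split.
- by move=> x; apply/F_iff.
- by move=> x y /F_iff xy; apply/F_iff/S_sym.
- by move=> x y z /F_iff xy /F_iff yz; apply/F_iff/(S_trans _ (F y)).
Qed.

Lemma classes_bij :
  (forall u, exists x, S (F x) u) ->
  exists f : set T -> set U, set_bij (classes R) (classes S) f.
Proof.
case: S_equiv => S_refl S_sym S_trans F_surj.
(* The [S]-saturation of the image of [X] under [F]: no representative of [X] has to be chosen. *)
pose f (X : set T) := [set u | exists2 x, X x & S (F x) u].
have fE x : f (R x) = S (F x).
  apply/seteqP; split=> u; last by exists x => //; apply/F_iff.
  by case=> y /F_iff xy; exact: S_trans.
exists f; split.
- by move=> _ [x _ <-]; rewrite fE; exists (F x).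
- move=> _ _ /set_mem[x _ <-] /set_mem[y _ <-]; rewrite !fE => xy.
  by apply/seteqP; split=> z /F_iff Sz; apply/F_iff; rewrite ?xy // -xy.
- move=> _ [u _ <-]; have [x xu] := F_surj u.
  exists (R x); [by exists x | rewrite fE].
  by apply/seteqP; split=> v; apply: S_trans => //; apply: S_sym.
Qed.

End ClassTransfer.

Lemma ordS_neq (k : 'I_3) : k != ordS k.
Proof. exact: (d0_neq_d1 (fwd k)). Qed.

(** The value at [k] is [g (ord_pred k)], transported along [ord_predK k]; at [ordS k] the transport
    is along a loop, trivial by uniqueness of identity proofs on ['I_3]. *)
Lemma ordS_lift (P : 'I_3 -> Type) (g : forall k, P (ordS k)) :
  exists h : forall k, P k, forall k, h (ordS k) = g k.
Proof.
exists (fun k => ecast i (P i) (ord_predK k) (g (ord_pred k))) => k.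
move: (ord_predK _); rewrite ordSK => e.
by rewrite eq_axiomK.
Qed.

Section NormalizedPointings.
Variable C : graph_of_groups.
Implicit Types (a : prod_group (vA C)) (b : forall k, eA C k).

Definition normalized_pointing a : pointing C :=
  fun e => match e with (k, s) =>
    if s as s return vA C (d0 (k, s)) then a (ordS k) else 1 end.

Lemma incl_same k (x : vA C k) : incl k x k = x.
Proof. exact: dfwith_in. Qed.

Lemma incl_other k j (x : vA C k) : k != j -> incl k x j = 1.
Proof. by move=> kj; rewrite /incl dfwith_out. Qed.

(** Consecutive vertices differ, so at vertex [ordS k] only the forward factor of one [Phi] and the
    backward factor of the other survive. Indexing by [ordS k] keeps [ord_pred] out of the types. *)
Lemma prj_PhiE a b k :
  prj (ordS k) ((Phi (b (ordS k)))^-1 * incl (ordS k) (a (ordS k)) * Phi (b k))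
  = (alpha C (fwd (ordS k)) (b (ordS k)))^-1 * a (ordS k)
    * alpha C (bwd k) (b k).
Proof.
have prjM (u v : prod_group (vA C)) i : (u * v) i = u i * v i by [].
have prjV (u : prod_group (vA C)) i : u^-1 i = (u i)^-1 by [].
rewrite /prj /Phi !(prjM, prjV) !incl_same !(incl_other _ (ordS_neq _)).
rewrite (@incl_other (ordS (ordS k))) 1?eq_sym ?ordS_neq //.
by rewrite mulg1 mul1g.
Qed.

Lemma triple_equivE a a' :
  triple_equiv C a a' <-> exists b, forall k,
    a (ordS k) * alpha C (bwd k) (b k)
    = alpha C (fwd (ordS k)) (b (ordS k)) * a' (ordS k).
Proof.
split=> [[x [Hx xa]]|[b ab]].
  have [b bx] : exists b, forall k, Phi (b k) = x k.
    by exists (fun k => s2val (cid2 (Hx k))) => k; case: cid2.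
  exists b => k; rewrite xa -!bx ordSK prj_PhiE.
  by rewrite !mulgA mulgV mul1g.
exists (fun k => Phi (b k)); split=> [k|k]; first by exists (b k).
rewrite -(ord_predK k) ordSK prj_PhiE.
by rewrite -mulgA ab mulKg.
Qed.

Lemma triple_equiv_pointing_iso a a' :
  triple_equiv C a a' <->
  pointing_iso C (normalized_pointing a) (normalized_pointing a').
Proof.
rewrite triple_equivE; split=> [[b ab]|[c [b cb]]].
  exists (fun i => alpha C (fwd i) (b i)), b => -[k []] /=; first exact: ab.
  by rewrite mul1g mulg1.
(* The equation on the forward edge at [ordS k] forces [c (ordS k)] to be the image of
   [b (ordS k)]. *)
exists b => k; rewrite (cb (bwd k)); congr (_ * _).
by have := cb (fwd (ordS k)); rewrite /= mul1g mulg1.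
Qed.

Lemma normalized_pointing_surj (d : pointing C) :
  exists a, pointing_iso C (normalized_pointing a) d.
Proof.
have [a aE] := @ordS_lift (vA C) (fun k =>
  (d (fwd (ordS k)))^-1 * d (bwd k)).
(* With trivial edge elements, the forward equations [1 = c i * d (fwd i)] dictate this vertex
   element [c i]. *)
exists a, (fun i => (d (fwd i))^-1), (fun=> 1) => -[k []] /=.
  by rewrite gmulf1 mulg1 aE.
by rewrite gmulf1 mulg1 mulVg.
Qed.

End NormalizedPointings.

Theorem corollary2p12 (A0 : amalgam) (C0 := reference_graph A0) :
  Equivalence (triple_equiv C0) /\
  exists f : set (prod_group (vA C0)) -> set (pointing C0),
    set_bij (classes (triple_equiv C0)) (classes (pointing_iso C0)) f.
Proof.
have iso_equiv := pointing_iso_equiv C0.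
have F_iff := @triple_equiv_pointing_iso C0.
split; first exact: equivalence_preimage iso_equiv F_iff.
exact: classes_bij iso_equiv F_iff (@normalized_pointing_surj C0).
Qed.
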